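(* Fix a connected open subset $U$ of $\mathbb{H}$ and a right Fueter-regular function $f:U\to\mathbb{H}$. Fix an orthonormal basis $\mathcal{B}=(e_0,e_1,e_2,e_3)$ of $\mathbb{H}$ with $e_0=1$ and $e_1e_2=e_3$. Let us split the quaternionic variable of $f$ as $z_1+z_2e_2$, with $z_1,z_2$ in $\mathbb{C}_{e_1}$, and $f$ as $f(z_1+z_2e_2)=f_1(z_1,z_2)+e_2f_2(z_1,z_2)$, with $f_1,f_2$ taking values in $\mathbb{C}_{e_1}$. If $p\in U$, then there exist $g,h\in\mathbb{S}$ such that $df_p\in\mathrm{Lin}^{\mathbb{C}}_{gh}(\mathbb{H}_l,\mathbb{H}_r)$ if, and only if, the expressions $$\left(\left|\frac{\partial f_1}{\partial z_1}\right|^2-\left|\frac{\partial f_2}{\partial z_2}\right|^2\right)\frac{\partial f_1}{\partial \bar z_1}+\left(\overline{\frac{\partial f_2}{\partial z_1}}\frac{\partial f_1}{\partial z_1}+\frac{\partial f_1}{\partial z_2}\overline{\frac{\partial f_2}{\partial z_2}}\right)\frac{\partial f_2}{\partial \bar z_1}-\left(\overline{\frac{\partial f_2}{\partial z_1}}\frac{\partial f_2}{\partial z_2}+\overline{\frac{\partial f_1}{\partial z_1}}\frac{\partial f_1}{\partial z_2}\right)\overline{\frac{\partial f_2}{\partial \bar z_1}}$$ and $$\left(\frac{\partial f_2}{\partial z_1}\overline{\frac{\partial f_2}{\partial z_2}}+\frac{\partial f_1}{\partial z_1}\overline{\frac{\partial f_1}{\partial z_2}}\right)\frac{\partial f_1}{\partial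 \bar z_1}+\left(\overline{\frac{\partial f_2}{\partial z_1}}\frac{\partial f_1}{\partial z_1}+\frac{\partial f_1}{\partial z_2}\overline{\frac{\partial f_2}{\partial z_2}}\right)\overline{\frac{\partial f_1}{\partial \bar z_1}}-\left(\left|\frac{\partial f_1}{\partial z_2}\right|^2-\left|\frac{\partial f_2}{\partial z_1}\right|^2\right)\overline{\frac{\partial f_2}{\partial \bar z_1}}$$ both vanish at $p$.
   Context: $\mathbb{H}$ is the algebra of real quaternions, with scalar product $\langle x,y\rangle=\mathrm{Re}(x\bar y)$ and norm $|x|$; $\mathbb{S}=\{x\in\mathbb{H}:\mathrm{Re}(x)=0,|x|=1\}$. For $g\in\mathbb{S}$, $\mathbb{C}_g=\mathrm{span}_{\mathbb{R}}(1,g)$, a copy of the complex field; $\mathbb{H}=\mathbb{C}_{e_1}+\mathbb{C}_{e_1}e_2=\mathbb{C}_{e_1}+e_2\mathbb{C}_{e_1}$, and $\partial/\partial z_s,\partial/\partial\bar z_s$ are the usual Wirtinger derivatives with $e_1$ playing the role of the imaginary unit. For $g,h\in\mathbb{S}$, $\mathrm{Lin}^{\mathbb{C}}_{gh}(\mathbb{H}_l,\mathbb{H}_r)$ is the set of real linear maps $\Lambda:\mathbb{H}\to\mathbb{H}$ with $\Lambda(gx)=\Lambda(x)h$ for all $x\in\mathbb{H}$. A $C^1$ function $f:U\to\mathbb{H}$ is right Fueter-regular if $\frac{\partial f}{\partial x_0}+\frac{\partial f}{\partial x_1}i+\frac{\partial f}{\partial x_2}j+\frac{\partial f}{\partial x_3}k=0$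 on $U$, where $x=x_0+ix_1+jx_2+kx_3$; this is equivalent to $\sum_{\ell=0}^3df_p(e_\ell)e_\ell=0$ for all $p\in U$ and any orthonormal basis $(e_0,\dots,e_3)$ of $\mathbb{H}$ with $e_0=1$. The real differential $df_p$ is regarded as a real linear map $\mathbb{H}\to\mathbb{H}$. *)

(* Defs.v *)
From HB Require Import structures.
From mathcomp Require Import all_boot all_order all_algebra.
From mathcomp Require Import all_classical all_reals all_analysis.
From mathcomp Require Import ring.

Set Implicit Arguments.
Unset Strict Implicit.
Unset Printing Implicit Defensive.
Import Order.TTheory GRing.Theory Num.Theory.
Import numFieldNormedType.Exports.
Local Open Scope classical_set_scope.
Local Open Scope ring_scope.

(* Real quaternions: the row vector (x0, x1, x2, x3) stands for
   x0 + x1 i + x2 j + x3 k.  The real vector space structure and the topology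
   are those of 'rV[R]_4.  Beware that `|x| on this type is the sup norm of
   'rV[R]_4 (which induces the usual topology); the Euclidean norm of the
   quaternions is [qnorm] below. *)
Definition quat (R : realType) : Type := 'rV[R]_4.

HB.instance Definition _ (R : realType) := NormedModule.copy (quat R) 'rV[R]_4.
HB.instance Definition _ (R : realType) := Vector.copy (quat R) 'rV[R]_4.

Definition mkq (R : realType) (a b c d : R) : quat R :=
  \row_i nth 0 [:: a; b; c; d] i.

Definition qmul (R : realType) (x y : quat R) : quat R :=
  mkq (x 0 0 * y 0 0 - x 0 1 * y 0 1 - x 0 2 * y 0 2 - x 0 3 * y 0 3)
      (x 0 0 * y 0 1 + x 0 1 * y 0 0 + x 0 2 * y 0 3 - x 0 3 * y 0 2)
      (x 0 0 * y 0 2 - x 0 1 * y 0 3 + x 0 2 * y 0 0 + x 0 3 * y 0 1)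
      (x 0 0 * y 0 3 + x 0 1 * y 0 2 - x 0 2 * y 0 1 + x 0 3 * y 0 0).

Lemma mkqE (R : realType) (a b c d : R) :
  (mkq a b c d 0 0 = a) * (mkq a b c d 0 1 = b) *
  (mkq a b c d 0 2 = c) * (mkq a b c d 0 3 = d).
Proof. by rewrite !mxE. Qed.

Lemma quatP (R : realType) (x y : quat R) :
  x 0 0 = y 0 0 -> x 0 1 = y 0 1 -> x 0 2 = y 0 2 -> x 0 3 = y 0 3 -> x = y.
Proof.
move=> e0 e1 e2 e3; apply/rowP => -[[|[|[|[|//]]]] lti].
- by rewrite (_ : Ordinal lti = 0) //; exact: val_inj.
- by rewrite (_ : Ordinal lti = 1) //; exact: val_inj.
- by rewrite (_ : Ordinal lti = 2) //; exact: val_inj.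
- by rewrite (_ : Ordinal lti = 3) //; exact: val_inj.
Qed.

Section QuatRing.
Variable R : realType.
Implicit Types (x y z : quat R) (a : R).

Let qDE x y i : (x + y) 0 i = x 0 i + y 0 i. Proof. by rewrite mxE. Qed.
Let qZE a x i : (a *: x) 0 i = a * x 0 i. Proof. by rewrite mxE. Qed.

Lemma qmulA : associative (@qmul R).
Proof. by move=> x y z; apply: quatP; rewrite !mkqE; ring. Qed.

Lemma qmul1q : left_id (mkq 1 0 0 0) (@qmul R).
Proof. by move=> x; apply: quatP; rewrite !mkqE; ring. Qed.

Lemma qmulq1 : right_id (mkq 1 0 0 0) (@qmul R).
Proof. by move=> x; apply: quatP; rewrite !mkqE; ring. Qed.

Lemma qmulDl : left_distributive (@qmul R) +%R.
Proof. by move=> x y z; apply: quatP; rewrite !(mkqE, qDE); ring. Qed.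

Lemma qmulDr : right_distributive (@qmul R) +%R.
Proof. by move=> x y z; apply: quatP; rewrite !(mkqE, qDE); ring. Qed.

Lemma q1_neq0 : mkq 1 0 0 0 != 0 :> quat R.
Proof.
by apply/eqP => /rowP /(_ 0); rewrite !mxE /=; apply/eqP; exact: oner_neq0.
Qed.

HB.instance Definition _ := GRing.Zmodule_isNzRing.Build (quat R)
  qmulA qmul1q qmulq1 qmulDl qmulDr q1_neq0.

Lemma qscaleAl a x y : a *: (x * y) = (a *: x) * y.
Proof. by apply: quatP; rewrite !(mkqE, qZE); ring. Qed.

Lemma qscaleAr a x y : a *: (x * y) = x * (a *: y).
Proof. by apply: quatP; rewrite !(mkqE, qZE); ring. Qed.

HB.instance Definition _ :=
  GRing.Lmodule_isLalgebra.Build R (quat R) qscaleAl.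
HB.instance Definition _ :=
  GRing.Lalgebra_isAlgebra.Build R (quat R) qscaleAr.

End QuatRing.

Section QuatDefs.
Variable R : realType.
Notation H := (quat R).
Implicit Types (x y z g h : H) (f : H -> H) (U : set H) (e : 'I_4 -> H).

Definition qi : H := mkq 0 1 0 0.
Definition qj : H := mkq 0 0 1 0.
Definition qk : H := mkq 0 0 0 1.

Definition qRe x : R := x 0 0.
Definition qconj x : H := mkq (x 0 0) (- x 0 1) (- x 0 2) (- x 0 3).
Definition qdot x y : R := qRe (x * qconj y).
Definition qnorm x : R := Num.sqrt (qdot x x).

Definition imsphere : set H := [set x | qRe x = 0 /\ qnorm x = 1].

Definition Cplane g : set H := [set x | exists a b : R, x = a *: 1 + b *: g].

Definition orthonormal_basis e : Prop :=
  basis_of fullv (codom e) /\ forall a b, qdot (e a) (e b) = (a == b)%:R.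

Definition LinC g h : set {linear H -> H} :=
  [set L | forall x, L (g * x) = L x * h].

Definition C1_on U f : Prop :=
  (forall p, U p -> differentiable f p) /\
  forall v : H, {within U, continuous (fun p => 'd f p v)}.

Definition right_Fueter_regular U f : Prop :=
  C1_on U f /\
  forall p, U p ->
    'D_1 f p + 'D_qi f p * qi + 'D_qj f p * qj + 'D_qk f p * qk = 0.

(* f (z1 + z2 e2) = f1 (z1, z2) + e2 f2 (z1, z2) for z1, z2 in C_{e1}; the
   values of f1 and f2 off C_{e1} x C_{e1}, or outside of the copy of U in it,
   are irrelevant. *)
Definition splitting U e f (f1 f2 : H -> H -> H) : Prop :=
  forall z1 z2, Cplane (e 1) z1 -> Cplane (e 1) z2 -> U (z1 + z2 * e 2) ->
    [/\ Cplane (e 1) (f1 z1 z2), Cplane (e 1) (f2 z1 z2) &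
        f (z1 + z2 * e 2) = f1 z1 z2 + e 2 * f2 z1 z2].

(* Wirtinger derivatives in z = x + y u, with u as the imaginary unit; at z in
   C_u the two directional derivatives only see the restriction of phi
   to C_u. *)
Definition dz (u : H) (phi : H -> H) z : H :=
  2^-1 *: ('D_1 phi z - u * 'D_u phi z).
Definition dzbar (u : H) (phi : H -> H) z : H :=
  2^-1 *: ('D_1 phi z + u * 'D_u phi z).

End QuatDefs.

Arguments qi {R}.
Arguments qj {R}.
Arguments qk {R}.
Arguments imsphere {R}.

(* Main.v *)
From HB Require Import structures.
Require Import Defs.
From mathcomp Require Import all_boot all_order all_algebra.
From mathcomp Require Import all_classical all_reals all_analysis.
From mathcomp Require Import ring.
Import Order.TTheory GRing.Theory Num.Theory.
Import numFieldNormedType.Exports.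
Local Open Scope classical_set_scope.
Local Open Scope ring_scope.

Set Implicit Arguments.
Unset Strict Implicit.
Unset Printing Implicit Defensive.

(** The statement is pointwise: it only concerns the real linear map
    L = df_p, which satisfies the linear Fueter condition
    L(1) + L(i) i + L(j) j + L(k) k = 0.

    For such an L and any imaginary n one has the identity
      L(n x) - L(x) n = (L(n) - L(1) n) x^*         (regular_quasi_commute)
    where x^* is the conjugate of x.  Hence, as soon as a nonzero imaginary n
    satisfies L(n) = L(1) n, the map L belongs to Lin_{gg} for g = n / |n|.
    Conversely, if L belongs to Lin_{gh}, such an n exists: n = g if g = h, and
    any imaginary n orthogonal to h - g otherwise (LinC_iff_kernel).  So the
    question is whether the linear map T(n) = L(n) - L(1) n has a nontrivial
    kernel on the 3-dimensional space of imaginary quaternions, that is, whether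
    the three quaternions x = T(e1), y = T(e2), z = T(e3) are linearly dependent
    over the reals (kernel_iff_dependent).

    Three vectors of a 4-dimensional space are dependent if and only if their
    triple cross product vanishes; for quaternions this reads
    x y^* z = z y^* x (dependent_iff_cross).  Finally the Fueter condition makes
    x, y, z simple expressions in the six Wirtinger derivatives of the statement
    (frame_wirtinger), and with these values
      x y^* z - z y^* x = -4 (E1 + E2 e2),
    where E1 and E2 are the two expressions of the theorem, both in C_{e1}
    (cross_eq0_iff); so the left-hand side vanishes if and only if E1 and E2 do.

    The last two computations are polynomial identities.  They are checked in
    the standard basis and carried to (1, e1, e2, e1 e2) by the automorphism
    [frame] of the quaternions that maps i to e1 and j to e2. *)

(** * Computing with coordinates *)

Section QuaternionAlgebra.
Variable R : realType.
Notation H := (quat R).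
Implicit Types (x y z n k : H) (t : R).

Lemma quat_coord x : exists a b c d, x = mkq a b c d.
Proof.
by exists (x 0 0), (x 0 1), (x 0 2), (x 0 3); apply: quatP; rewrite !mkqE.
Qed.

Lemma mkqM (a b c d a' b' c' d' : R) :
  mkq a b c d * mkq a' b' c' d' =
  mkq (a * a' - b * b' - c * c' - d * d') (a * b' + b * a' + c * d' - d * c')
      (a * c' - b * d' + c * a' + d * b') (a * d' + b * c' - c * b' + d * a').
Proof. by apply: quatP; rewrite !mkqE. Qed.

Lemma mkqD (a b c d a' b' c' d' : R) :
  mkq a b c d + mkq a' b' c' d' = mkq (a + a') (b + b') (c + c') (d + d').
Proof. by apply: quatP; rewrite mxE !mkqE. Qed.

Lemma mkqN (a b c d : R) : - mkq a b c d = mkq (- a) (- b) (- c) (- d).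
Proof. by apply: quatP; rewrite mxE !mkqE. Qed.

Lemma mkqZ t (a b c d : R) :
  t *: mkq a b c d = mkq (t * a) (t * b) (t * c) (t * d).
Proof. by apply: quatP; rewrite mxE !mkqE. Qed.

Lemma mkq_conj (a b c d : R) : qconj (mkq a b c d) = mkq a (- b) (- c) (- d).
Proof. by rewrite /qconj !mkqE. Qed.

Lemma mkq1 : 1 = mkq 1 0 0 0 :> H. Proof. by []. Qed.

Lemma mkq0 : 0 = mkq 0 0 0 0 :> H.
Proof. by apply: quatP; rewrite mxE !mkqE. Qed.

(** Reduces a quaternion expression in explicit coordinates to a single [mkq].
    [mkqE] is included because [mkqD] and its companions may fire on a product,
    which unfolds to an [mkq], before the product itself is reduced. *)
Definition mkq_simp := (mkqM, mkqD, mkqN, mkqZ, mkq_conj, mkqE).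

Lemma mkq_inj (a b c d a' b' c' d' : R) :
  mkq a b c d = mkq a' b' c' d' -> [/\ a = a', b = b', c = c' & d = d'].
Proof.
move=> E; have C i := congr1 (fun x : H => x 0 i) E.
by move: (C 0) (C 1) (C 2) (C 3); rewrite /= !mkqE.
Qed.

Lemma qdotE x y :
  qdot x y = x 0 0 * y 0 0 + x 0 1 * y 0 1 + x 0 2 * y 0 2 + x 0 3 * y 0 3.
Proof. by rewrite /qdot /qRe !mkqE; ring. Qed.

Lemma qReD x y : qRe (x + y) = qRe x + qRe y.
Proof. by rewrite /qRe mxE. Qed.

Lemma qReZ t x : qRe (t *: x) = t * qRe x.
Proof. by rewrite /qRe mxE. Qed.

Lemma qmul_conj x : x * qconj x = qdot x x *: 1.
Proof.
rewrite qdotE; have [a [b [c [d ->]]]] := quat_coord x.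
by rewrite !mkqE mkq1 !mkq_simp; congr mkq; ring.
Qed.

Lemma qconj_mul x : qconj x * x = qdot x x *: 1.
Proof.
rewrite qdotE; have [a [b [c [d ->]]]] := quat_coord x.
by rewrite !mkqE mkq1 !mkq_simp; congr mkq; ring.
Qed.

Lemma qdot_ge0 x : 0 <= qdot x x.
Proof. by rewrite qdotE -!expr2 !addr_ge0 ?sqr_ge0. Qed.

Lemma qdot_eq0 x : (qdot x x == 0) = (x == 0).
Proof.
apply/eqP/eqP => [|->]; last by rewrite qdotE !mxE !mulr0 !addr0.
rewrite qdotE -!expr2 => /eqP.
rewrite !paddr_eq0 ?addr_ge0 ?sqr_ge0 // !sqrf_eq0.
move=> /andP[/andP[/andP[/eqP ? /eqP ?] /eqP ?] /eqP ?].
by apply: quatP; rewrite mxE.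
Qed.

Lemma qnorm_sqr x : qnorm x ^+ 2 = qdot x x.
Proof. by rewrite sqr_sqrtr ?qdot_ge0. Qed.

Lemma qmul_eq0r x k : k != 0 -> x * k = 0 -> x = 0.
Proof.
move=> k0 xk0; have := congr1 ( *%R^~ (qconj k)) xk0.
rewrite /= mul0r -mulrA qmul_conj -scalerAr mulr1 => /eqP.
by rewrite scaler_eq0 qdot_eq0 (negbTE k0) => /eqP.
Qed.

Lemma imag_conj n : qRe n = 0 -> qconj n = - n.
Proof.
have [a [b [c [d ->]]]] := quat_coord n; rewrite /qRe mkqE => ->.
by rewrite mkqN mkq_conj oppr0.
Qed.

(** * Linear maps that satisfy the Fueter condition *)

Lemma linear_quatE (L : {linear H -> H}) y :
  L y = y 0 0 *: L 1 + y 0 1 *: L qi + y 0 2 *: L qj + y 0 3 *: L qk.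
Proof.
rewrite -!linearZ -!linearD; congr (L _).
have [a [b [c [d ->]]]] := quat_coord y.
by rewrite /qi /qj /qk mkq1 !mkq_simp; congr mkq; ring.
Qed.

(** Both sides are trilinear in (L, n, x), and the Fueter condition allows to
    express L(1) through L(i), L(j), L(k): it is a polynomial identity.
    Conceptually, a Fueter-regular L is of the form
    L(x) = P x^* i + Q x^* j + S x^* k, and n e_l + e_l n is real for
    imaginary n. *)
Lemma regular_quasi_commute (L : {linear H -> H}) n x :
  L 1 + L qi * qi + L qj * qj + L qk * qk = 0 -> qRe n = 0 ->
  L (n * x) - L x * n = (L n - L 1 * n) * qconj x.
Proof.
move=> reg n0.
have LE := linear_quatE L.
have L1 : L 1 = - (L qi * qi + L qj * qj + L qk * qk).
  by apply/eqP; rewrite -addr_eq0 !addrA reg.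
rewrite (LE (n * x)) (LE x) (LE n) L1; move: n0.
have [a [b [c [d ->]]]] := quat_coord n; rewrite /qRe mkqE => ->.
have [x0 [x1 [x2 [x3 ->]]]] := quat_coord x.
have [a0 [a1 [a2 [a3 ->]]]] := quat_coord (L qi).
have [b0 [b1 [b2 [b3 ->]]]] := quat_coord (L qj).
have [c0 [c1 [c2 [c3 ->]]]] := quat_coord (L qk).
by rewrite /qi /qj /qk !mkq_simp; congr mkq; ring.
Qed.

Lemma exists_orthogonal k : qRe k = 0 ->
  exists n, [/\ n != 0, qRe n = 0 & n * k = - (k * n)].
Proof.
have [a [b [c [d ->]]]] := quat_coord k; rewrite /qRe mkqE => ->.
have [/eqP b0|b0] := boolP (b == 0); last first.
  exists (mkq 0 c (- b) 0); split; rewrite ?mkqE //.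
    apply: contraNneq b0; rewrite mkq0 => /mkq_inj[_ _ /eqP].
    by rewrite oppr_eq0.
  by rewrite !mkq_simp; congr mkq; ring.
exists qi; split; rewrite ?mkqE //.
  by rewrite mkq0; apply/eqP => /mkq_inj[_ /eqP]; rewrite oner_eq0.
by rewrite /qi b0 !mkq_simp; congr mkq; ring.
Qed.

(** If L(g x) = L(x) h, then [regular_quasi_commute] gives
    L(x) (h - g) = (L(1) (h - g)) x^*.  An imaginary n orthogonal to h - g
    anticommutes with it, so that L(n) (h - g) = L(1) n (h - g). *)
Lemma LinC_iff_kernel (L : {linear H -> H}) :
  L 1 + L qi * qi + L qj * qj + L qk * qk = 0 ->
  (exists g h, [/\ imsphere g, imsphere h & LinC g h L]) <->
  exists n, [/\ n != 0, qRe n = 0 & L n = L 1 * n].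
Proof.
move=> reg; split=> [[g [h [[g0 g1] [h0 _] Lgh]]]|[n [n0 nI Ln]]].
  have Lx x : L x * (h - g) = (L 1 * (h - g)) * qconj x.
    have := regular_quasi_commute x reg g0; rewrite Lgh mulrBr => ->.
    by have := Lgh 1; rewrite mulr1 => ->; rewrite mulrBr.
  have [/eqP hg|hg] := boolP (h - g == 0).
    exists g; split=> //.
      apply: contra_eq_neq g1 => ->; rewrite /qnorm qdotE !mxE !mul0r !addr0.
      by rewrite sqrtr0 eq_sym oner_neq0.
    by have := Lgh 1; rewrite mulr1 => ->; rewrite (subr0_eq hg).
  have kI : qRe (h - g) = 0.
    by rewrite -scaleN1r qReD qReZ h0 g0 mulr0 addr0.
  have [n [n0 nI nk]] := exists_orthogonal kI.
  exists n; split=> //; apply: subr0_eq; apply: (qmul_eq0r hg).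
  by rewrite mulrBl Lx imag_conj // mulrN -!mulrA nk mulrN subrr.
have nn : qnorm n != 0 by rewrite sqrtr_eq0 -ltNge lt_def qdot_eq0 n0 qdot_ge0.
pose u := (qnorm n)^-1 *: n.
have uS : imsphere u.
  split; first by rewrite /qRe mxE -/(qRe n) nI mulr0.
  rewrite /qnorm -(sqrtr1 R); congr Num.sqrt.
  apply: (mulfI (expf_neq0 2 nn)); rewrite mulr1 {2}qnorm_sqr !qdotE !mxE.
  by field.
exists u, u; split=> // x; apply: subr0_eq.
rewrite regular_quasi_commute //; last by case: uS.
by rewrite linearZ /= Ln -scalerAr subrr mul0r.
Qed.

(** * The triple cross product *)

(** The imaginary part of a commutator is twice the cross product of the
    imaginary parts, so the imaginary parts of commuting quaternions are
    parallel. *)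
Lemma commute_span x y : x * y = y * x ->
  exists s t r, ((s != 0) || (t != 0)) /\ s *: x + t *: y = r *: 1.
Proof.
have [x0 [x1 [x2 [x3 ->]]]] := quat_coord x.
have [y0 [y1 [y2 [y3 ->]]]] := quat_coord y.
rewrite mkq1 !mkqM => /mkq_inj[_ /eqP + /eqP + /eqP].
set e1 := (X in X == _ -> _); rewrite -subr_eq0 => E1.
rewrite -subr_eq0 => E2; rewrite -subr_eq0 => E3.
have {}E1 : x2 * y3 - x3 * y2 = 0.
  apply: (mulfI (_ : 2 != 0)) => //; rewrite mulr0 -[RHS](eqP E1) /e1; ring.
have {}E2 : x3 * y1 - x1 * y3 = 0.
  apply: (mulfI (_ : 2 != 0)) => //; rewrite mulr0 -[RHS](eqP E2); ring.
have {}E3 : x1 * y2 - x2 * y1 = 0.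
  apply: (mulfI (_ : 2 != 0)) => //; rewrite mulr0 -[RHS](eqP E3); ring.
have [/eqP x10|x10] := boolP (x1 == 0); last first.
  exists (- y1), x1, (- y1 * x0 + x1 * y0); rewrite x10 orbT; split=> //.
  rewrite !mkq_simp; congr mkq; rewrite ?mulr0 ?mulr1 //; first ring.
    by rewrite -E3; ring.
  by rewrite -[RHS]oppr0 -E2; ring.
have [/eqP x20|x20] := boolP (x2 == 0); last first.
  exists (- y2), x2, (- y2 * x0 + x2 * y0); rewrite x20 orbT; split=> //.
  rewrite !mkq_simp; congr mkq; rewrite ?mulr0 ?mulr1 //; last 1 first.
  - by rewrite -E1; ring.
  - by rewrite -[RHS]oppr0 -E3; ring.
  - by ring.
have [/eqP x30|x30] := boolP (x3 == 0); last first.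
  exists (- y3), x3, (- y3 * x0 + x3 * y0); rewrite x30 orbT; split=> //.
  rewrite !mkq_simp; congr mkq; rewrite ?mulr0 ?mulr1 //; last 1 first.
  - by ring.
  - by rewrite -E2; ring.
  - by rewrite -[RHS]oppr0 -E1; ring.
exists 1, 0, x0; rewrite oner_neq0; split=> //.
by rewrite x10 x20 x30 !mkq_simp; congr mkq; ring.
Qed.

(** Up to a factor, x y^* z - z y^* x is the alternating trilinear cross product
    of three vectors of a 4-dimensional space; this gives the direct implication.
    Conversely, if it vanishes and y <> 0, then x y^* and z y^* commute, so a
    nontrivial combination of them is real, i.e. a multiple of y y^*, and y^*
    can be cancelled. *)
Lemma dependent_iff_cross x y z :
  (exists a b c : R, [|| a != 0, b != 0 | c != 0] /\
     a *: x + b *: y + c *: z = 0) <->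
  x * qconj y * z = z * qconj y * x.
Proof.
split=> [[a [b [c [nz E]]]]|E].
  case/or3P: nz => nz.
  - have -> : x = (- (b / a)) *: y + (- (c / a)) *: z.
      apply: (scalerI nz); rewrite scalerDr !scalerA !mulrN !(mulrCA a).
      rewrite mulfV // !mulr1.
      by apply/eqP; rewrite !scaleNr -opprD -addr_eq0 addrA E.
    have [y0 [y1 [y2 [y3 ->]]]] := quat_coord y.
    have [z0 [z1 [z2 [z3 ->]]]] := quat_coord z.
    move: (- (b / a)) (- (c / a)) => s t.
    by rewrite !mkq_simp; congr mkq; ring.
  - have -> : y = (- (a / b)) *: x + (- (c / b)) *: z.
      apply: (scalerI nz); rewrite scalerDr !scalerA !mulrN !(mulrCA b).
      rewrite mulfV // !mulr1.
      by apply/eqP; rewrite !scaleNr -opprD -addr_eq0 addrCA addrA E.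
    have [x0 [x1 [x2 [x3 ->]]]] := quat_coord x.
    have [z0 [z1 [z2 [z3 ->]]]] := quat_coord z.
    move: (- (a / b)) (- (c / b)) => s t.
    by rewrite !mkq_simp; congr mkq; ring.
  - have -> : z = (- (a / c)) *: x + (- (b / c)) *: y.
      apply: (scalerI nz); rewrite scalerDr !scalerA !mulrN !(mulrCA c).
      rewrite mulfV // !mulr1.
      by apply/eqP; rewrite !scaleNr -opprD -addr_eq0 addrC E.
    have [y0 [y1 [y2 [y3 ->]]]] := quat_coord y.
    have [x0 [x1 [x2 [x3 ->]]]] := quat_coord x.
    move: (- (a / c)) (- (b / c)) => s t.
    by rewrite !mkq_simp; congr mkq; ring.
have [->|y0] := eqVneq y 0.
  by exists 0, 1, 0; rewrite oner_neq0 orbT !scale0r scaler0 !addr0.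
have /commute_span[s [t [r [nz F]]]] :
  (x * qconj y) * (z * qconj y) = (z * qconj y) * (x * qconj y).
  by rewrite mulrA E mulrA.
have yy : qdot y y != 0 by rewrite qdot_eq0.
exists (qdot y y * s), (- r), (qdot y y * t); split.
  by rewrite !mulf_eq0 (negbTE yy) /=; case/orP: nz => ->; rewrite ?orbT.
have := congr1 ( *%R^~ y) F.
rewrite /= mulrDl -!scalerAl -!mulrA qconj_mul mul1r -!scalerAr !mulr1.
by rewrite !scalerA scaleNr addrAC mulrC (mulrC t) => ->; rewrite subrr.
Qed.

End QuaternionAlgebra.

(** * Directional derivatives of the components *)

Section Components.
Variable R : realType.
Notation H := (quat R).
Implicit Types (x y z u v w : H).

Lemma quat_linear_continuous (A : {linear H -> H}) : continuous A.
Proof.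
rewrite (funext (linear_quatE A)) => x.
have cvZ i (a : H) : (y : H) 0 i *: a @[y --> x] --> x 0 i *: a.
  apply: (@cvgZr_tmp R H H (nbhs x) _ (fun y : H => y 0 i) (x 0 i) a).
   exact: (@coord_continuous R 1 4 0 i x).
by apply: cvgD (cvZ _ _); apply: cvgD (cvZ _ _); exact: cvgD.
Qed.

(** It is enough that phi agrees with A \o F along the line z + t v: this is the
    case of f1 and f2, which f determines on C_{e1} x C_{e1} only. *)
Lemma derive_linear_comp (F phi : H -> H) (A : {linear H -> H}) p z v w :
  differentiable F p ->
  (\forall t \near (0 : R), phi (t *: v + z) = A (F (t *: w + p))) ->
  'D_v phi z = A ('d F p w).
Proof.
move=> dF phiE; rewrite -deriveE // /derive.
have E0 : phi z = A (F p).
  by have := nbhs_singleton phiE; rewrite !scale0r !add0r.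
have cF : h^-1 *: ((F \o shift p) (h *: w) - F p) @[h --> (0 : R)^'] -->
    'D_w F p.
  exact: (@diff_derivable _ _ _ F p w).
have cA := @continuous_cvg _ _ _ _ _ _ A _ (@quat_linear_continuous A _) cF.
suff cphi : h^-1 *: ((phi \o shift z) (h *: v) - phi z) @[h --> (0 : R)^'] -->
    A ('D_w F p).
  exact: (@cvg_lim H (@norm_hausdorff R H)) cphi.
refine (cvg_trans (near_eq_cvg _) (cA _)).
have : \forall t \near (0 : R)^', phi (t *: v + z) = A (F (t *: w + p)).
  exact: cvg_within phiE.
apply: filterS => t /= ->.
by rewrite E0 linearZ linearB.
Qed.

(** For orthonormal imaginary units u and v, the conjugation x |-> - u x u fixes
    C_u and changes the sign of v C_u.  So [Cpart] and [Ccopart] recover a and b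
    from a + v b when a and b are in C_u (see [parts_of_split]); both formulas
    make sense on all of H and are linear, as [derive_linear_comp] requires. *)
Definition Cpart u x : H := 2^-1 *: (x - u * x * u).

Definition Ccopart u v x : H := - 2^-1 *: (v * (x + u * x * u)).

Lemma Cpart_is_linear u : linear (Cpart u).
Proof.
move=> a x y; rewrite /Cpart mulrDr mulrDl -scalerAr -scalerAl opprD addrACA.
by rewrite -scalerBr scalerDr !scalerA mulrC.
Qed.
HB.instance Definition _ u :=
  GRing.isLinear.Build R H H _ (Cpart u) (Cpart_is_linear u).

Lemma Ccopart_is_linear u v : linear (Ccopart u v).
Proof.
move=> a x y; rewrite /Ccopart [u * (_ + _)]mulrDr mulrDl.
rewrite -scalerAr -scalerAl addrACA.
by rewrite -scalerDr mulrDr -scalerAr scalerDr !scalerA mulrC.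
Qed.
HB.instance Definition _ u v :=
  GRing.isLinear.Build R H H _ (Ccopart u v) (Ccopart_is_linear u v).

Lemma Cpart_mkq (a b c d : R) : Cpart qi (mkq a b c d) = mkq a b 0 0.
Proof. by rewrite /Cpart /qi !mkq_simp; congr mkq; field. Qed.

Lemma Ccopart_mkq (a b c d : R) :
  Ccopart qi qj (mkq a b c d) = mkq c (- d) 0 0.
Proof. by rewrite /Ccopart /qi /qj !mkq_simp; congr mkq; field. Qed.

Lemma Cplane1 u : Cplane u 1.
Proof. by exists 1, 0; rewrite scale0r addr0 scale1r. Qed.

Lemma Cplane_unit u : Cplane u u.
Proof. by exists 0, 1; rewrite scale0r add0r scale1r. Qed.

Lemma CplaneD u x y : Cplane u x -> Cplane u y -> Cplane u (x + y).
Proof.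
move=> [a [b ->]] [c [d ->]]; exists (a + c), (b + d).
by rewrite !scalerDl addrACA.
Qed.

Lemma CplaneZ u t x : Cplane u x -> Cplane u (t *: x).
Proof.
by move=> [a [b ->]]; exists (t * a), (t * b); rewrite scalerDr !scalerA.
Qed.

Lemma CplaneN u x : Cplane u x -> Cplane u (- x).
Proof. by rewrite -scaleN1r; exact: CplaneZ. Qed.

Lemma Cplane_conj u x : qRe u = 0 -> Cplane u x -> Cplane u (qconj x).
Proof.
move=> u0 [a [b ->]]; exists a, (- b); move: u0.
have [p0 [p1 [p2 [p3 ->]]]] := quat_coord u.
rewrite /qRe mkqE => ->.
by rewrite mkq1 !mkq_simp; congr mkq; ring.
Qed.

Lemma CplaneM u x y : u * u = -1 ->
  Cplane u x -> Cplane u y -> Cplane u (x * y).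
Proof.
move=> uu [a [b ->]] [c [d ->]]; exists (a * c - b * d), (a * d + b * c).
rewrite mulrDl !mulrDr -!scalerAl -!scalerAr !mul1r !mulr1 uu mkq1.
have [p0 [p1 [p2 [p3 ->]]]] := quat_coord u.
by rewrite !mkq_simp; congr mkq; ring.
Qed.

End Components.

(** * The two expressions in the standard basis *)

Section StandardBasis.
Variable R : realType.
Notation H := (quat R).

(** The two expressions of the theorem, for a, b the derivatives of f1 with
    respect to z1, z2, for c, d those of f2, and for a', c' the derivatives of
    f1, f2 with respect to the conjugate of z1. *)
Definition first_expr (a b c d a' c' : H) : H :=
  (qnorm a ^+ 2 - qnorm d ^+ 2) *: a' + (qconj c * a + b * qconj d) * c'
    - (qconj c * d + qconj a * b) * qconj c'.

Definition second_expr (a b c d a' c' : H) : H :=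
  (c * qconj d + a * qconj b) * a' + (qconj c * a + b * qconj d) * qconj a'
    - (qnorm b ^+ 2 - qnorm c ^+ 2) *: qconj c'.

(** The Fueter condition determines the derivatives of f1 and f2 with respect to
    the conjugate of z2, so the six complex numbers a, b, c, d, a', c' are
    coordinates on the 12-dimensional real space of Fueter-regular linear maps;
    x, y, z are then T(i), T(j), T(k), as computed in [std_wirtinger]. *)
Lemma std_cross (a0 a1 b0 b1 c0 c1 d0 d1 a0' a1' c0' c1' : R) :
  let a := mkq a0 a1 0 0 in let b := mkq b0 b1 0 0 in
  let c := mkq c0 c1 0 0 in let d := mkq d0 d1 0 0 in
  let a' := mkq a0' a1' 0 0 in let c' := mkq c0' c1' 0 0 in
  let x := -2 *: ((a' + qj * c') * qi) in
  let y := (b + qconj c) + qj * (d - qconj a) in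
  let z := ((b - qconj c) + qj * (d + qconj a)) * qi in
  x * qconj y * z - z * qconj y * x =
  -4 *: (first_expr a b c d a' c' + second_expr a b c d a' c' * qj).
Proof.
rewrite /= /first_expr /second_expr !qnorm_sqr !qdotE /qi /qj !mkqE.
have -> : -2 *: ((mkq a0' a1' 0 0 + mkq 0 0 1 0 * mkq c0' c1' 0 0) *
    mkq 0 1 0 0) = mkq (2 * a1') (- 2 * a0') (2 * c1') (2 * c0').
  by rewrite !mkq_simp; congr mkq; ring.
have -> : (mkq b0 b1 0 0 + qconj (mkq c0 c1 0 0)) +
    mkq 0 0 1 0 * (mkq d0 d1 0 0 - qconj (mkq a0 a1 0 0)) =
    mkq (b0 + c0) (b1 - c1) (d0 - a0) (- (d1 + a1)).
  by rewrite !mkq_simp; congr mkq; ring.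
have -> : ((mkq b0 b1 0 0 - qconj (mkq c0 c1 0 0)) +
    mkq 0 0 1 0 * (mkq d0 d1 0 0 + qconj (mkq a0 a1 0 0))) * mkq 0 1 0 0 =
    mkq (- (b1 + c1)) (b0 - c0) (a1 - d1) (- (d0 + a0)).
  by rewrite !mkq_simp; congr mkq; ring.
by rewrite !mkq_simp; congr mkq; ring.
Qed.

(** A, B, C, D stand for L(1), L(i), L(j), L(k); the hypothesis is the identity
    [regular_quasi_commute] for n = i and x = j. *)
Lemma std_wirtinger (A B C D : H) :
  D - C * qi = - ((B - A * qi) * qj) ->
  let a := 2^-1 *: (Cpart qi A - qi * Cpart qi B) in
  let b := 2^-1 *: (Cpart qi C - qi * Cpart qi D) in
  let c := 2^-1 *: (Ccopart qi qj A - qi * Ccopart qi qj B) in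
  let d := 2^-1 *: (Ccopart qi qj C - qi * Ccopart qi qj D) in
  let a' := 2^-1 *: (Cpart qi A + qi * Cpart qi B) in
  let c' := 2^-1 *: (Ccopart qi qj A + qi * Ccopart qi qj B) in
  [/\ B - A * qi = -2 *: ((a' + qj * c') * qi),
      C - A * qj = (b + qconj c) + qj * (d - qconj a) &
      D - A * (qi * qj) = ((b - qconj c) + qj * (d + qconj a)) * qi].
Proof.
move/eqP; rewrite subr_eq => /eqP E.
have [a0 [a1 [a2 [a3 EA]]]] := quat_coord A.
have [b0 [b1 [b2 [b3 EB]]]] := quat_coord B.
have [c0 [c1 [c2 [c3 EC]]]] := quat_coord C.
have -> : D = mkq (- c1 + b2 - a3) (c0 + b3 + a2)
                  (c3 - b0 - a1) (- c2 - b1 + a0).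
  by rewrite E EA EB EC /qi /qj !mkq_simp; congr mkq; ring.
rewrite /= EA EB EC !(Cpart_mkq, Ccopart_mkq) /qi /qj.
by split; rewrite !mkq_simp; congr mkq; field.
Qed.

Lemma std_parts (a b c d : R) :
  let x := mkq a b 0 0 + qj * mkq c d 0 0 in
  Cpart qi x = mkq a b 0 0 /\ Ccopart qi qj x = mkq c d 0 0.
Proof.
rewrite /= /Cpart /Ccopart /qi /qj.
by split; rewrite !mkq_simp; congr mkq; field.
Qed.

End StandardBasis.

(** * Transport to another orthonormal basis *)

Section Frame.
Variable R : realType.
Notation H := (quat R).
Implicit Types (x y : H).
Variables e1 e2 : H.

Definition imag_orthonormal : Prop :=
  [/\ qRe e1 = 0, qRe e2 = 0, qdot e1 e1 = 1, qdot e2 e2 = 1 &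
      qdot e1 e2 = 0].

Definition frame x : H :=
  x 0 0 *: 1 + x 0 1 *: e1 + x 0 2 *: e2 + x 0 3 *: (e1 * e2).

Lemma frame_mkq a b c d :
  frame (mkq a b c d) = a *: 1 + b *: e1 + c *: e2 + d *: (e1 * e2).
Proof. by rewrite /frame !mkqE. Qed.

Hypothesis e12_on : imag_orthonormal.

Let e10 : qRe e1 = 0. Proof. by case: e12_on. Qed.
Let e20 : qRe e2 = 0. Proof. by case: e12_on. Qed.
Let e11 : qdot e1 e1 = 1. Proof. by case: e12_on. Qed.
Let e22 : qdot e2 e2 = 1. Proof. by case: e12_on. Qed.
Let e12 : qdot e1 e2 = 0. Proof. by case: e12_on. Qed.

Lemma e1_sqr : e1 * e1 = -1.
Proof.
by apply: oppr_inj; rewrite opprK -mulrN -imag_conj // qmul_conj e11 scale1r.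
Qed.

Lemma e2_sqr : e2 * e2 = -1.
Proof.
by apply: oppr_inj; rewrite opprK -mulrN -imag_conj // qmul_conj e22 scale1r.
Qed.

Lemma e12_anticomm : e2 * e1 = - (e1 * e2).
Proof.
move: e10 e20 e12; rewrite qdotE.
have [a [b [c [d ->]]]] := quat_coord e1.
have [a' [b' [c' [d' ->]]]] := quat_coord e2.
rewrite /qRe !mkqE => -> -> E; rewrite !mkq_simp; congr mkq; try ring.
apply: subr0_eq; rewrite -[RHS](mulr0 (- 2)) -[in RHS]E; ring.
Qed.

Lemma e12_imag : qRe (e1 * e2) = 0.
Proof.
move: e10 e20 e12; rewrite qdotE /qRe.
have [a [b [c [d ->]]]] := quat_coord e1.
have [a' [b' [c' [d' ->]]]] := quat_coord e2.
rewrite !mkqE => -> -> E; rewrite -[RHS]oppr0 -[in RHS]E; ring.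
Qed.

Lemma frameD x y : frame (x + y) = frame x + frame y.
Proof.
rewrite /frame !mxE; have [p0 [p1 [p2 [p3 ->]]]] := quat_coord e1.
have [q0 [q1 [q2 [q3 ->]]]] := quat_coord e2.
by rewrite mkq1 !mkq_simp; congr mkq; ring.
Qed.

Lemma frameZ t x : frame (t *: x) = t *: frame x.
Proof. by rewrite /frame !mxE !scalerDr !scalerA. Qed.

Lemma frameN x : frame (- x) = - frame x.
Proof. by rewrite -scaleN1r frameZ scaleN1r. Qed.

Lemma frame1 : frame 1 = 1.
Proof. by rewrite mkq1 frame_mkq !scale0r !addr0 scale1r. Qed.

Lemma frame_qi : frame qi = e1.
Proof. by rewrite /qi frame_mkq !scale0r !addr0 add0r scale1r. Qed.

Lemma frame_qj : frame qj = e2.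
Proof. by rewrite /qj frame_mkq !scale0r !addr0 !add0r scale1r. Qed.

Lemma frameM x y : frame (x * y) = frame x * frame y.
Proof.
have [a [b [c [d ->]]]] := quat_coord x.
have [a' [b' [c' [d' ->]]]] := quat_coord y.
rewrite mkqM !frame_mkq !mulrDl !mulrDr -!scalerAl -!scalerAr !mul1r !mulr1.
have -> : e1 * (e1 * e2) = - e2 by rewrite mulrA e1_sqr mulN1r.
have E212 : e2 * (e1 * e2) = e1.
  by rewrite mulrA e12_anticomm mulNr -mulrA e2_sqr mulrN mulr1 opprK.
have -> : e1 * e2 * e1 = e2.
  by rewrite -mulrA e12_anticomm mulrN mulrA e1_sqr mulN1r opprK.
have -> : e1 * e2 * e2 = - e1 by rewrite -mulrA e2_sqr mulrN mulr1.
have -> : e1 * e2 * (e1 * e2) = -1.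
  by rewrite -mulrA E212 e1_sqr.
rewrite E212 e12_anticomm e1_sqr e2_sqr mkq1; move: (e1 * e2) => e3.
have [p0 [p1 [p2 [p3 ->]]]] := quat_coord e1.
have [q0 [q1 [q2 [q3 ->]]]] := quat_coord e2.
have [r0 [r1 [r2 [r3 ->]]]] := quat_coord e3.
by rewrite !mkq_simp; congr mkq; ring.
Qed.

Lemma frame_conj x : frame (qconj x) = qconj (frame x).
Proof.
have [a [b [c [d ->]]]] := quat_coord x.
rewrite mkq_conj !frame_mkq.
move: e10 e20 e12_imag; rewrite /qRe mkq1; move: (e1 * e2) => e3.
have [p0 [p1 [p2 [p3 ->]]]] := quat_coord e1.
have [q0 [q1 [q2 [q3 ->]]]] := quat_coord e2.
have [r0 [r1 [r2 [r3 ->]]]] := quat_coord e3.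
rewrite !mkqE => -> -> ->.
by rewrite !mkq_simp; congr mkq; ring.
Qed.

Lemma frame_qdot x : qdot (frame x) (frame x) = qdot x x.
Proof.
have : qdot (frame x) (frame x) *: 1 = qdot x x *: 1 :> H.
  by rewrite -qmul_conj -frame_conj -frameM qmul_conj frameZ frame1.
by rewrite mkq1 !mkqZ => /mkq_inj[]; rewrite !mulr1.
Qed.

Lemma frame_eq0 x : frame x = 0 -> x = 0.
Proof. by move=> x0; apply/eqP; rewrite -qdot_eq0 -frame_qdot x0 qdot_eq0. Qed.

Lemma frame_qnorm x : qnorm (frame x) = qnorm x.
Proof. by rewrite /qnorm frame_qdot. Qed.

Lemma qRe_frame x : qRe (frame x) = qRe x.
Proof.
rewrite /frame !(qReD, qReZ) e10 e20 e12_imag.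
by rewrite /qRe mkqE !mulr0 !addr0 mulr1.
Qed.

Definition frame_simp := (frameM, frameD, frameN, frameZ, frame_conj,
  frame_qi, frame_qj).

Lemma frame_Cpart x : frame (Cpart qi x) = Cpart e1 (frame x).
Proof. by rewrite /Cpart !frame_simp. Qed.

Lemma frame_Ccopart x : frame (Ccopart qi qj x) = Ccopart e1 e2 (frame x).
Proof. by rewrite /Ccopart !frame_simp. Qed.

Lemma frame_Cplane x : Cplane e1 x <-> exists a b, x = frame (mkq a b 0 0).
Proof.
by split=> -[a [b ->]]; exists a, b; rewrite frame_mkq !scale0r !addr0.
Qed.

Lemma parts_of_split x y : Cplane e1 x -> Cplane e1 y ->
  Cpart e1 (x + e2 * y) = x /\ Ccopart e1 e2 (x + e2 * y) = y.
Proof.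
move=> /frame_Cplane[a [b ->]] /frame_Cplane[c [d ->]].
have [E1 E2] := std_parts a b c d.
rewrite -[X in X * frame _]frame_qj -frameM -frameD.
by rewrite -frame_Cpart -frame_Ccopart E1 E2.
Qed.

Lemma Cplane_split_eq0 x y : Cplane e1 x -> Cplane e1 y ->
  x + y * e2 = 0 -> x = 0 /\ y = 0.
Proof.
move=> /frame_Cplane[a [b ->]] /frame_Cplane[c [d ->]].
rewrite -[X in _ * X]frame_qj -frameM -frameD => /frame_eq0.
rewrite /qj !mkq_simp mkq0 => /mkq_inj[a0 b0 c0 d0].
suff [-> -> -> ->] : [/\ a = 0, b = 0, c = 0 & d = 0].
  by rewrite frame_mkq !scale0r !addr0 mkq0.
split.
- by rewrite -[RHS]a0; ring.
- by rewrite -[RHS]b0; ring.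
- by rewrite -[RHS]c0; ring.
- by rewrite -[RHS]d0; ring.
Qed.

(** The identity of [std_cross] transported by [frame]; the two summands E1 and
    E2 e2 lie in the complementary planes C_{e1} and C_{e1} e2. *)
Lemma cross_eq0_iff a b c d a' c' :
  Cplane e1 a -> Cplane e1 b -> Cplane e1 c -> Cplane e1 d ->
  Cplane e1 a' -> Cplane e1 c' ->
  let x := -2 *: ((a' + e2 * c') * e1) in
  let y := (b + qconj c) + e2 * (d - qconj a) in
  let z := ((b - qconj c) + e2 * (d + qconj a)) * e1 in
  x * qconj y * z = z * qconj y * x <->
  first_expr a b c d a' c' = 0 /\ second_expr a b c d a' c' = 0.
Proof.
move=> Ca Cb Cc Cd Ca' Cc' x y z.
have C1 : Cplane e1 (first_expr a b c d a' c').
  by rewrite /first_expr; repeat first [apply: CplaneD | apply: CplaneN |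
    apply: (CplaneM e1_sqr) | apply: CplaneZ | apply: (Cplane_conj e10)].
have C2 : Cplane e1 (second_expr a b c d a' c').
  by rewrite /second_expr; repeat first [apply: CplaneD | apply: CplaneN |
    apply: (CplaneM e1_sqr) | apply: CplaneZ | apply: (Cplane_conj e10)].
have cross : x * qconj y * z - z * qconj y * x =
    -4 *: (first_expr a b c d a' c' + second_expr a b c d a' c' * e2).
  move: Ca Cb Cc Cd Ca' Cc' @x @y @z {C1 C2}.
  move=> /frame_Cplane[a0 [a1 ->]] /frame_Cplane[b0 [b1 ->]].
  move=> /frame_Cplane[c0 [c1 ->]] /frame_Cplane[d0 [d1 ->]].
  move=> /frame_Cplane[a0' [a1' ->]] /frame_Cplane[c0' [c1' ->]] /=.
  have := congr1 frame (std_cross a0 a1 b0 b1 c0 c1 d0 d1 a0' a1' c0' c1').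
  rewrite /first_expr /second_expr !frame_qnorm /=.
  by rewrite !frame_simp.
split=> [/eqP|[E1 E2]]; last first.
  by apply: subr0_eq; rewrite cross E1 E2 mul0r addr0 scaler0.
rewrite -subr_eq0 cross scaler_eq0 oppr_eq0 pnatr_eq0 /= => /eqP.
exact: Cplane_split_eq0.
Qed.

(** By [frame_surj], this holds for the orthonormal bases of the theorem. *)
Hypothesis surj : forall x, exists y, x = frame y.

Lemma kernel_iff_dependent (L : {linear H -> H}) :
  (exists n, [/\ n != 0, qRe n = 0 & L n = L 1 * n]) <->
  exists a b c : R, [|| a != 0, b != 0 | c != 0] /\
    a *: (L e1 - L 1 * e1) + b *: (L e2 - L 1 * e2)
      + c *: (L (e1 * e2) - L 1 * (e1 * e2)) = 0.
Proof.
have T a b c : L (frame (mkq 0 a b c)) - L 1 * frame (mkq 0 a b c) =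
    a *: (L e1 - L 1 * e1) + b *: (L e2 - L 1 * e2)
      + c *: (L (e1 * e2) - L 1 * (e1 * e2)).
  rewrite frame_mkq scale0r add0r !linearD !linearZ /= !mulrDr -!scalerAr.
  by rewrite !scalerN !opprD [LHS]addrACA [in LHS](addrACA (a *: _)).
split=> [[n [n0 nI Ln]]|[a [b [c [nz E]]]]].
  have [y yE] := surj n; move: n0 nI Ln; rewrite yE qRe_frame /qRe.
  have [y0 [a [b [c ->]]]] := quat_coord y; rewrite mkqE => n0 y00.
  rewrite y00 in n0 *; move=> /eqP; rewrite -subr_eq0 T => /eqP E.
  exists a, b, c; split=> //; apply: contraNT n0.
  rewrite !negb_or !negbK => /and3P[/eqP -> /eqP -> /eqP ->].
  by rewrite frame_mkq !scale0r !addr0.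
exists (frame (mkq 0 a b c)); split.
- apply: contraL nz => /eqP /frame_eq0.
  by rewrite mkq0 => /mkq_inj[_ -> -> ->]; rewrite eqxx.
- by rewrite qRe_frame /qRe mkqE.
- by apply: subr0_eq; rewrite T.
Qed.

(** [std_wirtinger] transported by [frame], for A, B, C, D the values of L at
    1, e1, e2, e1 e2. *)
Lemma frame_wirtinger (A B C D : H) :
  D - C * e1 = - ((B - A * e1) * e2) ->
  let a := 2^-1 *: (Cpart e1 A - e1 * Cpart e1 B) in
  let b := 2^-1 *: (Cpart e1 C - e1 * Cpart e1 D) in
  let c := 2^-1 *: (Ccopart e1 e2 A - e1 * Ccopart e1 e2 B) in
  let d := 2^-1 *: (Ccopart e1 e2 C - e1 * Ccopart e1 e2 D) in
  let a' := 2^-1 *: (Cpart e1 A + e1 * Cpart e1 B) in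
  let c' := 2^-1 *: (Ccopart e1 e2 A + e1 * Ccopart e1 e2 B) in
  [/\ B - A * e1 = -2 *: ((a' + e2 * c') * e1),
      C - A * e2 = (b + qconj c) + e2 * (d - qconj a) &
      D - A * (e1 * e2) = ((b - qconj c) + e2 * (d + qconj a)) * e1].
Proof.
have [A' ->] := surj A; have [B' ->] := surj B.
have [C' ->] := surj C; have [D' ->] := surj D => E.
have /std_wirtinger[] : D' - C' * qi = - ((B' - A' * qi) * qj).
  by apply: subr0_eq; apply: frame_eq0; rewrite !frame_simp E subrr.
move=> /(congr1 frame) E1 /(congr1 frame) E2 /(congr1 frame) E3.
split; [move: E1 | move: E2 | move: E3];
  by rewrite !(frame_simp, frame_Cpart, frame_Ccopart).
Qed.

Lemma Cplane_Cpart x : Cplane e1 (Cpart e1 x).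
Proof.
have [y ->] := surj x; rewrite -frame_Cpart; apply/frame_Cplane.
by have [a [b [c [d ->]]]] := quat_coord y; exists a, b; rewrite Cpart_mkq.
Qed.

Lemma Cplane_Ccopart x : Cplane e1 (Ccopart e1 e2 x).
Proof.
have [y ->] := surj x; rewrite -frame_Ccopart; apply/frame_Cplane.
have [a [b [c [d ->]]]] := quat_coord y; exists c, (- d).
by rewrite Ccopart_mkq.
Qed.

End Frame.

(** The matrix E of coordinates of the basis satisfies E E^T = 1, hence also
    E^T E = 1, so the coordinates of x in the basis are x E^T. *)
Lemma frame_surj (R : realType) (e : 'I_4 -> quat R) x :
  (forall a b, qdot (e a) (e b) = (a == b)%:R) ->
  e 0 = 1 -> e 1 * e 2 = e 3 ->
  exists y, x = frame (e 1) (e 2) y.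
Proof.
move=> on e0 e3.
pose E : 'M[R]_4 := \matrix_(i, j) e i 0 j.
have /mulmx1C EE : E *m E^T = 1%:M.
  apply/matrixP => i j; rewrite !mxE -on qdotE !big_ord_recl big_ord0 !mxE.
  rewrite addr0 !addrA.
  by do !congr (_ + _); congr (e _ _ _ * e _ _ _); exact: val_inj.
exists ((x : 'rV_4) *m E^T).
rewrite -[LHS](mulmx1 (x : 'rV_4)) -EE mulmxA /frame -e0 e3.
apply/rowP => j; rewrite mxE; move: (_ *m E^T) => y.
rewrite !mxE !big_ord_recl big_ord0 !mxE addr0 !addrA.
by do !congr (_ + _); congr (y _ _ * e _ _ _); exact: val_inj.
Qed.

Theorem theorem4p9 (R : realType) (U : set (quat R)) (f : quat R -> quat R)
    (e : 'I_4 -> quat R) (f1 f2 : quat R -> quat R -> quat R)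
    (p z1 z2 : quat R) :
  open U -> connected U ->
  right_Fueter_regular U f ->
  orthonormal_basis e -> e 0 = 1 -> e 1 * e 2 = e 3 ->
  splitting U e f f1 f2 ->
  U p -> Cplane (e 1) z1 -> Cplane (e 1) z2 -> p = z1 + z2 * e 2 ->
  let d1f1 := dz (e 1) (fun z => f1 z z2) z1 in
  let d2f1 := dz (e 1) (fun z => f1 z1 z) z2 in
  let d1f2 := dz (e 1) (fun z => f2 z z2) z1 in
  let d2f2 := dz (e 1) (fun z => f2 z1 z) z2 in
  let d1barf1 := dzbar (e 1) (fun z => f1 z z2) z1 in
  let d1barf2 := dzbar (e 1) (fun z => f2 z z2) z1 in
  (exists g h : quat R,
      [/\ imsphere g, imsphere h & LinC g h ('d f p)])
  <->
  ((qnorm d1f1 ^+ 2 - qnorm d2f2 ^+ 2) *: d1barf1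
    + (qconj d1f2 * d1f1 + d2f1 * qconj d2f2) * d1barf2
    - (qconj d1f2 * d2f2 + qconj d1f1 * d2f1) * qconj d1barf2 = 0
  /\
   (d1f2 * qconj d2f2 + d1f1 * qconj d2f1) * d1barf1
    + (qconj d1f2 * d1f1 + d2f1 * qconj d2f2) * qconj d1barf1
    - (qnorm d2f1 ^+ 2 - qnorm d1f2 ^+ 2) *: qconj d1barf2 = 0).
Proof.
move=> oU _ [[df _] reg] [_ on] e0 e3 spl Up Cz1 Cz2 pE.
have {df} dfp := df p Up.
have {reg} := reg p Up; rewrite !deriveE //; set L := 'd f p => reg.
have eI k : k != 0 -> qRe (e k) = 0.
  move=> /negbTE k0; rewrite -[RHS]/(false%:R) -k0 -on e0 qdotE mkq1 !mkqE.
  by rewrite !mulr0 !addr0 mulr1.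
have on12 : imag_orthonormal (e 1) (e 2) by split; rewrite ?on // eI.
have surj x := frame_surj x on e0 e3.
pose P := Cpart (e 1); pose Q := Ccopart (e 1) (e 2).
have near_U w : \forall t \near (0 : R), U (t *: w + p).
  have cw : t *: w + p @[t --> (0 : R)] --> p.
    rewrite -[X in _ --> X]add0r -[X in _ --> X + _](scale0r w).
    by apply: cvgD; [apply: cvgZr_tmp; exact: cvg_id | exact: cvg_cst].
  exact: cw (open_nbhs_nbhs (conj oU Up)).
have parts x y : Cplane (e 1) x -> Cplane (e 1) y -> U (x + y * e 2) ->
    f1 x y = P (f (x + y * e 2)) /\ f2 x y = Q (f (x + y * e 2)).
  move=> Cx Cy Uxy; have [C1 C2 ->] := spl x y Cx Cy Uxy.
  by rewrite /P /Q; have [-> ->] := parts_of_split on12 C1 C2.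
have D1 v : Cplane (e 1) v ->
    'D_v (fun z => f1 z z2) z1 = P (L v) /\
    'D_v (fun z => f2 z z2) z1 = Q (L v).
  move=> Cv.
  have key t : t *: v + z1 + z2 * e 2 = t *: v + p by rewrite pE addrA.
  have Ct t : Cplane (e 1) (t *: v + z1).
    by apply: CplaneD => //; exact: CplaneZ.
  by split; apply: derive_linear_comp => //; apply: filterS (near_U v) => t;
    rewrite -key => Ut; have [] := parts _ z2 (Ct t) Cz2 Ut.
have D2 v : Cplane (e 1) v ->
    'D_v (fun z => f1 z1 z) z2 = P (L (v * e 2)) /\
    'D_v (fun z => f2 z1 z) z2 = Q (L (v * e 2)).
  move=> Cv.
  have key t : z1 + (t *: v + z2) * e 2 = t *: (v * e 2) + p.
    by rewrite mulrDl -scalerAl addrCA -pE.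
  have Ct t : Cplane (e 1) (t *: v + z2).
    by apply: CplaneD => //; exact: CplaneZ.
  by split; apply: derive_linear_comp => //;
    apply: filterS (near_U (v * e 2)) => t;
    rewrite -key => Ut; have [] := parts z1 _ Cz1 (Ct t) Ut.
have C1 : Cplane (e 1) 1 := Cplane1 (e 1).
have Ce : Cplane (e 1) (e 1) := Cplane_unit (e 1).
have [D11 D12] := D1 _ C1; have [De1 De2] := D1 _ Ce.
have [D21 D22] := D2 _ C1; have [Df1 Df2] := D2 _ Ce.
rewrite mul1r in D21 D22.
rewrite /= /dz /dzbar D11 D12 De1 De2 D21 D22 Df1 Df2.
(* The Fueter condition in the basis e, in the form needed for the Wirtinger
   derivatives. *)
have reg2 : L (e 1 * e 2) - L (e 2) * e 1 = - ((L (e 1) - L 1 * e 1) * e 2).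
  by rewrite (regular_quasi_commute _ reg) ?(imag_conj (n := e 2)) ?eI // mulrN.
have [E1 E2 E3] := frame_wirtinger on12 surj reg2.
rewrite (LinC_iff_kernel reg).
rewrite (kernel_iff_dependent on12 surj).
rewrite dependent_iff_cross E1 E2 E3.
have CP x : Cplane (e 1) (P x) by exact: (Cplane_Cpart on12 surj).
have CQ x : Cplane (e 1) (Q x) by exact: (Cplane_Ccopart on12 surj).
by apply: (cross_eq0_iff on12);
  repeat first [exact: CP | exact: CQ | exact: Ce | apply: CplaneZ |
    apply: CplaneD | apply: CplaneN | apply: (CplaneM (e1_sqr on12))].
Qed.
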